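(* Let $m\geq1$, let $f=f(y^1,\dots,y^m)$ be a $\mathcal{C}^\infty$-smooth function from $\mathbb{K}^m$ to $\mathbb{K}$, let $g^1=g^1(x),\dots,g^m=g^m(x)$ be $\mathcal{C}^\infty$-smooth functions from $\mathbb{K}$ to $\mathbb{K}$, and let $h(x):=f(g^1(x),\dots,g^m(x))$. For every integer $\kappa\geq1$, the $\kappa$-th derivative of $h$ with respect to $x$ is given by the following explicit polynomial with integer coefficients in the partial derivatives of $f$ (evaluated at $y=(g^1(x),\dots,g^m(x))$) and the derivatives of the $g^l$: $$ \begin{aligned} \frac{d^\kappa h}{dx^\kappa} &=\sum_{d=1}^\kappa\ \sum_{1\leq\lambda_1<\cdots<\lambda_d\leq\kappa}\ \sum_{\substack{\mu_1\geq1,\dots,\mu_d\geq1\\ \mu_1\lambda_1+\cdots+\mu_d\lambda_d=\kappa}}\ \frac{\kappa!}{(\lambda_1!)^{\mu_1}\,\mu_1!\cdots(\lambda_d!)^{\mu_d}\,\mu_d!}\ \sum_{l_{1:1},\dots,l_{1:\mu_1}=1}^m\cdots\sum_{l_{d:1},\dots,l_{d:\mu_d}=1}^m\\ &\quad\frac{\partial^{\mu_1+\cdots+\mu_d}f}{\partial y^{l_{1:1}}\cdots\partial y^{l_{1:\mu_1}}\cdots\partial y^{l_{d:1}}\cdots\partial y^{l_{d:\mu_d}}}\ \prod_{1\leq\nu_1\leq\mu_1}\frac{d^{\lambda_1}g^{l_{1:\nu_1}}}{dx^{\lambda_1}}\ \cdots\prod_{1\leq\nu_d\leq\mu_d}\frac{d^{\lambda_d}g^{l_{d:\nu_d}}}{dx^{\lambda_d}}.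 \end{aligned} $$
   Context: $\mathbb{K}=\mathbb{R}$ or $\mathbb{C}$. The $\lambda_e$ and $\mu_e$ are integers; $l_{e:\nu}$ ($1\leq e\leq d$, $1\leq\nu\leq\mu_e$) are independent summation indices with values in $\{1,\dots,m\}$. *)

(* Defs.v *)
From HB Require Import structures.
From mathcomp Require Import all_boot all_order all_algebra complex.
From mathcomp Require Import all_classical all_reals all_analysis.

Set Implicit Arguments.
Unset Strict Implicit.
Unset Printing Implicit Defensive.

Import Order.TTheory GRing.Theory Num.Theory.
Import numFieldNormedType.Exports.

Local Open Scope ring_scope.
Local Open Scope classical_set_scope.

Section Smoothness.
Variable K : numFieldType.

(* partialn [:: l1; ...; ln] f is d^n f / (dy^l1 ... dy^ln), the derivation
   along y^ln being performed first. *)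
Definition partialn (m : nat) (s : seq 'I_m) (f : 'rV[K]_m -> K) :
    'rV[K]_m -> K :=
  foldr (fun (l : 'I_m) (F : 'rV[K]_m -> K) => 'D_(delta_mx 0 l) F) f s.

(* When K is the field of complex numbers, the derivatives below are complex
   derivatives. 'D_v and ^`(n) being total operators, the existence of the
   derivatives has to be required through derivable. *)
Definition smooth_mv (m : nat) (f : 'rV[K]_m -> K) : Prop :=
  forall s : seq 'I_m,
    (forall (l : 'I_m) (y : 'rV[K]_m),
       derivable (partialn s f) y (delta_mx 0 l)) /\
    continuous (partialn s f).

Definition smooth_1v (g : K -> K) : Prop :=
  forall (n : nat) (x : K), derivable (g^`(n)) x 1.

End Smoothness.

Section Indices.
Variables kappa d : nat.

Definition lambda_ok (lam : {ffun 'I_d -> 'I_kappa.+1}) : bool :=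
  [forall e, (0 < lam e)%N] &&
  [forall e1 : 'I_d, forall e2 : 'I_d, (e1 < e2)%N ==> (lam e1 < lam e2)%N].

(* The bound mu e <= kappa carried by the type is no restriction: it follows
   from lam e >= 1 and from the equation. *)
Definition mu_ok (lam mu : {ffun 'I_d -> 'I_kappa.+1}) : bool :=
  [forall e, (0 < mu e)%N] && (\sum_(e < d) mu e * lam e == kappa)%N.

Definition fdb_denom (lam mu : {ffun 'I_d -> 'I_kappa.+1}) : nat :=
  (\prod_(e < d) ((lam e)`! ^ mu e * (mu e)`!))%N.

(* A choice of all the summation indices: tnth (l e) nu is l_{e:nu}. *)
Definition indices (m : nat) (mu : {ffun 'I_d -> 'I_kappa.+1}) : finType :=
  {dffun forall e : 'I_d, (mu e).-tuple 'I_m}.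

Definition indices_seq (m : nat) (mu : {ffun 'I_d -> 'I_kappa.+1})
    (l : indices m mu) : seq 'I_m :=
  flatten [seq tval (l e) | e : 'I_d].

End Indices.

(* Main.v *)
Require Import Defs.
From HB Require Import structures.
From mathcomp Require Import all_boot all_order all_algebra complex.
From mathcomp Require Import all_classical all_reals all_analysis.
From mathcomp Require Import ring zify.

(* Collecting equal terms, the n-th derivative of h is a sum over the partitions of n, the
   partition c with c_i blocks of size i carrying the weight n! / prod_i (i!^c_i c_i!) and the
   term D_c obtained by contracting a partial derivative of f of order sum_i c_i with c_i
   derivatives of order i of the inner functions, for each i. The derivative of D_c is
   D_(c + e_1) + sum_i c_i D_(c - e_i + e_(i+1)), and the weights satisfy the matching recursion,
   whence an induction on n. Terms are recognized as equal up to the order of the partial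
   derivatives, so Schwarz's theorem is needed; it and the multivariate chain rule follow, for
   real and complex scalars alike, from the mean value inequality along the coordinate
   directions. *)

Set Implicit Arguments.
Unset Strict Implicit.
Unset Printing Implicit Defensive.

Import Order.TTheory GRing.Theory Num.Theory.
Import numFieldNormedType.Exports.

Local Open Scope ring_scope.
Local Open Scope classical_set_scope.

(** * The mean value inequality *)

(** With [is_derive_approx] as converse, this replaces the limit over a punctured neighbourhood by
    an increment bound valid at [t = 0] too, a form in which derivability can be carried from [K] to
    [R]. *)
Lemma derivable_approx (K : numFieldType) (phi : K -> K) (x : K) :
  derivable phi x 1 -> forall e : K, 0 < e -> exists2 d : K, 0 < d &
    forall t, `|t| < d -> `|phi (x + t) - phi x - t * phi^`()%classic x| <= e * `|t|.
Proof.
move=> dphi e e0; rewrite derive1E.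
have : h^-1 *: (phi (h *: 1 + x) - phi x) @[h --> 0^'] --> 'D_1 phi x by [].
move/cvgrPdist_le => /(_ e e0) /nbhs_ballP[d /= d0 dP]; exists d => // t td.
have [->|t0] := eqVneq t 0; first by rewrite addr0 subrr mul0r subr0 normr0 mulr0.
have := dP t; rewrite /ball /= sub0r normrN => /(_ td t0).
rewrite /GRing.scale /= mulr1 (addrC t) => le_e.
rewrite -ler_pdivrMr ?normr_gt0// -normf_div; apply: le_trans le_e.
rewrite -normrN le_eqVlt; apply/orP; left; apply/eqP; congr `|_|; field; exact: t0.
Qed.

Lemma is_derive_approx (K : numFieldType) (phi : K -> K) (x l : K) :
  (forall e : K, 0 < e -> exists2 d : K, 0 < d &
    forall t, `|t| < d -> `|phi (x + t) - phi x - t * l| <= e * `|t|) ->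
  is_derive x 1 phi l.
Proof.
move=> H.
have cv : h^-1 *: (phi (h *: 1 + x) - phi x) @[h --> 0^'] --> l.
  apply/cvgrPdist_le => e e0; have [d d0 dP] := H e e0.
  apply/nbhs_ballP; exists d => //= t.
  rewrite /ball /= sub0r normrN => /dP td t0.
  rewrite /GRing.scale /= mulr1 (addrC t).
  move: td; rewrite -ler_pdivrMr ?normr_gt0// -normf_div; apply: le_trans.
  rewrite -normrN le_eqVlt; apply/orP; left; apply/eqP; congr `|_|; field; exact: t0.
by apply: DeriveDef; [apply/cvg_ex; exists l|apply: cvg_lim].
Qed.

(* The only property of the scalars used below: the mean value equality fails for complex
   derivatives. *)
Definition mean_value_bound (K : numFieldType) : Prop :=
  forall phi : K -> K, (forall x, derivable phi x 1) ->
  forall a h c e : K,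
    (forall z, `|z - a| <= `|h| -> `|phi^`()%classic z - c| <= e) ->
    `|phi (a + h) - phi a - c * h| <= e * `|h|.

(* re w is the projection onto the direction of w, scaled by the norm of w. Taking w to be the
   error term reduces the claim to the real mean value theorem on the segment from a to a + h. *)
Lemma mean_value_bound_embed (R : realType) (K : numFieldType)
    (io : {rmorphism R -> K}) (re : K -> K -> R) :
    (forall t, `|io t| = io `|t|) ->
    (forall z : K, 0 <= z -> exists t, z = io t) ->
    (forall w, {morph re w : x y / x - y}) ->
    (forall w t x, re w (io t * x) = t * re w x) ->
    (forall w x, io `|re w x| <= `|w| * `|x|) ->
    (forall w, io (re w w) = `|w| ^+ 2) ->
  mean_value_bound K.
Proof.
move=> ion ioP reB reM re_le re_w phi dphi a h c e eP.
have io_le s t : (io s <= io t) = (s <= t).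
  rewrite -subr_ge0 -rmorphB -[RHS]subr_ge0; apply/idP/idP => [le_st|/normr_idP <-].
    have := ion (t - s); rewrite (ger0_norm le_st) => /fmorph_inj ->.
    exact: normr_ge0.
  by rewrite -ion.
have io_lt s t : (io s < io t) = (s < t).
  by rewrite !lt_def io_le (inj_eq (fmorph_inj io)).
set w := phi (a + h) - phi a - c * h.
pose psi t := re w (phi (a + io t * h) - c * (io t * h)).
pose dpsi t := re w ((phi^`()%classic (a + io t * h) - c) * h).
have drv (t : R) : is_derive t (1 : R) psi (dpsi t).
  apply: is_derive_approx => e1 e10.
  (* The error of [phi] at the increment [s * h] reaches [psi] multiplied by at most [|w|], whence
     [k = |w| * |h|]. Adding 1 to [k] and to [|h|] keeps the divisors positive when [w] or [h] is
     0. *)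
  have [k kE] := ioP (`|w| * `|h|) (mulr_ge0 (normr_ge0 _) (normr_ge0 _)).
  have k0 : 0 <= k by rewrite -io_le rmorph0 -kE mulr_ge0.
  have e2 : 0 < io (e1 / (k + 1)) by rewrite -(rmorph0 io) io_lt divr_gt0 ?ltr_wpDl.
  have [d d0 dP] := derivable_approx (dphi (a + io t * h)) e2.
  have [h1 h1E] := ioP (`|h| + 1) (addr_ge0 (normr_ge0 _) ler01).
  have h10 : 0 < h1 by rewrite -io_lt rmorph0 -h1E ltr_wpDl.
  have [d1 d1E] := ioP d (ltW d0).
  have d10 : 0 < d1 by rewrite -io_lt rmorph0 -d1E.
  exists (d1 / h1); first exact: divr_gt0.
  move=> s; rewrite ltr_pdivlMr// => sd.
  have : `|io s * h| < d.
    rewrite normrM ion d1E; apply: le_lt_trans (_ : io (`|s| * h1) < _); last by rewrite io_lt.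
    by rewrite rmorphM -h1E ler_wpM2l ?lerDl// -ion.
  move=> /dP le1; rewrite -io_le.
  have -> : psi (t + s) - psi t - s * dpsi t =
     re w (phi (a + io t * h + io s * h) - phi (a + io t * h)
            - io s * h * phi^`()%classic (a + io t * h)).
    rewrite /psi /dpsi -reM -!reB; congr (re w _).
    by rewrite rmorphD mulrDl addrA; ring.
  apply: le_trans (re_le _ _) _; apply: le_trans (ler_wpM2l (normr_ge0 _) le1) _.
  have -> : `|w| * (io (e1 / (k + 1)) * `|io s * h|) = io (e1 / (k + 1) * k * `|s|).
    by rewrite normrM ion !rmorphM -kE; ring.
  rewrite io_le; apply: ler_wpM2r => //.
  by rewrite -mulrA ler_piMr ?(ltW e10)// mulrC ler_pdivrMr ?ltr_wpDl// mul1r lerDl.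
have [t t01 tE] : exists2 t, t \in `[0, 1]%R & psi 1 - psi 0 = dpsi t * (1 - 0).
  apply: MVT_segment => //.
  by apply: derivable_within_continuous => t _.
have wE : re w w = dpsi t.
  rewrite subr0 mulr1 in tE; rewrite -tE /psi -reB rmorph1 rmorph0; congr (re w _).
  by rewrite !mul1r mul0r mulr0 subr0 addr0 /w; ring.
have [->|w0] := eqVneq w 0.
  have e0 : 0 <= e by apply: le_trans (eP a _) => //; rewrite subrr normr0.
  by rewrite normr0 mulr_ge0.
have wgt0 : 0 < `|w| by rewrite normr_gt0.
(* Multiplied by [|w|], the left-hand side becomes [|w| ^+ 2], which is the image of [dpsi t];
   [re_le] then brings back a factor [|w|] to cancel. *)
rewrite -(ler_pM2l wgt0) -expr2 -re_w wE.
apply: le_trans (_ : io `|dpsi t| <= _); first by rewrite io_le ler_norm.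
apply: le_trans (re_le _ _) _; rewrite ler_pM2l// normrM ler_wpM2r//.
apply: eP; rewrite addrAC subrr add0r normrM ion ler_piMl//.
move: t01; rewrite in_itv /= => /andP[t0 t1].
by rewrite -(rmorph1 io) io_le ger0_norm.
Qed.

Lemma mean_value_bound_real (R : realType) : mean_value_bound R.
Proof.
apply: (@mean_value_bound_embed R R idfun (fun w x => w * x)) => //=.
- by move=> z _; exists z.
- by move=> w x y; rewrite mulrBr.
- by move=> w t x; rewrite mulrCA.
- by move=> w x; rewrite normrM.
- by move=> w; rewrite -normrX ger0_norm// ?sqr_ge0.
Qed.

(** The real part of [w^* x] is the Euclidean inner product of the plane. *)
Lemma mean_value_bound_complex (R : realType) : mean_value_bound R[i]%C.
Proof.
apply: (@mean_value_bound_embed R R[i]%C (real_complex R)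
  (fun w x => complex.Re (w^*%C * x))) => //=.
- by move=> t; rewrite normc_def /= expr0n addr0 sqrtr_sqr.
- by move=> z z0; exists (complex.Re z); rewrite /= RRe_real// ger0_real.
- by move=> w x y; rewrite mulrBr raddfB.
- by move=> w t [x y]; case: w => u v /=; ring.
- by move=> w x; apply: le_trans (normc_ge_Re _) _; rewrite normrM normcJ.
- by move=> w; rewrite /= mulrC -sqr_normc RRe_real//.
Qed.

(** * Schwarz's theorem *)

(** Adjacent transpositions generate all permutations: the head of [s] is located in [t], the tails
    are matched by induction, and the head is moved into place one swap at a time. *)
Lemma seq_perm_ind (T : eqType) (V : Type) (F : seq T -> V) :
    (forall s1 a b s2, F (s1 ++ [:: a, b & s2]) = F (s1 ++ [:: b, a & s2])) ->
  forall s t, perm_eq s t -> F s = F t.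
Proof.
move=> swapF s; elim: s F swapF => [|a s IH] F swapF t.
  by rewrite perm_sym => /perm_nilP ->.
move=> /[dup] /perm_mem /(_ a); rewrite mem_head => /esym.
case/splitPr=> t1 t2 st.
have st' : perm_eq s (t1 ++ t2).
  by rewrite -(perm_cons a) (perm_trans st)// -cat1s perm_catCA.
rewrite (IH (fun r => F (a :: r)) _ _ st'); last first.
  by move=> s1 x y s2; exact: (swapF (a :: s1)).
elim/last_ind: t1 t2 {st st'} => // t1 b IH1 t2.
by rewrite cat_rcons IH1 swapF cat_rcons.
Qed.

Section MeanValue.
Variables (K : numFieldType) (mvbK : mean_value_bound K) (m : nat).
Implicit Types (F : 'rV[K]_m -> K) (y z : 'rV[K]_m) (l : 'I_m).

Let e_ l : 'rV[K]_m := delta_mx 0 l.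

Lemma derive_line F z l (t : K) :
  derivable F (z + t *: e_ l) (e_ l) ->
  is_derive t (1 : K) (fun s => F (z + s *: e_ l)) ('D_(e_ l) F (z + t *: e_ l)).
Proof.
move=> dF.
have E : (fun h : K => h^-1 *: (F (z + (h *: 1 + t) *: e_ l) - F (z + t *: e_ l))) =
         (fun h : K => h^-1 *: (F (h *: e_ l + (z + t *: e_ l)) - F (z + t *: e_ l))).
  apply/funext => h; congr (_ *: (F _ - _)).
  by rewrite -[h *: 1]/(h * 1) mulr1 scalerDl addrCA.
by apply: DeriveDef; rewrite /derivable /derive /= E.
Qed.

Lemma partial_mean_value F z l (h c e : K) :
    (forall y, derivable F y (e_ l)) ->
    (forall t : K, `|t| <= `|h| -> `|'D_(e_ l) F (z + t *: e_ l) - c| <= e) ->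
  `|F (z + h *: e_ l) - F z - c * h| <= e * `|h|.
Proof.
move=> dF le_e.
have D t := derive_line (dF (z + t *: e_ l)).
have := @mvbK (fun s => F (z + s *: e_ l)) (fun t => @ex_derive _ _ _ _ _ _ _ (D t)) 0 h c e.
rewrite add0r scale0r addr0; apply => t; rewrite subr0 => /le_e.
by rewrite derive1E (@derive_val _ _ _ _ _ _ _ (D t)).
Qed.

Lemma continuous_ball F y : {for y, continuous F} -> forall e : K, 0 < e ->
  exists2 d : K, 0 < d & forall v : 'rV[K]_m, `|v| < d -> `|F (y + v) - F y| < e.
Proof.
move=> cF e e0.
have /cvgrPdist_lt/(_ e e0)/nbhs_ballP[d /= d0 dP] := cF.
exists d => // v vd; rewrite distrC; apply: dP.
by rewrite -ball_normE /= opprD addrA subrr sub0r normrN.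
Qed.

Lemma norm_rowE y : `|y| = 0 \/ exists j, `|y| = `|y 0 j|.
Proof.
have [y0|y0] := eqVneq (mx_norm y) 0; first by left.
by right; have [[i j] yij] := mx_norm_neq0 y0; exists j; rewrite /= ord1 in yij.
Qed.

Lemma norm_delta_le (t : K) l : `|t *: e_ l| <= `|t|.
Proof.
have [->|[j ->]] := norm_rowE (t *: e_ l); first exact: normr_ge0.
rewrite !mxE normrM ler_piMr//.
by case: (_ && _); rewrite ?normr1 ?normr0 ?ler01.
Qed.

(** Both mixed derivatives, times [t ^ 2], approximate the same second difference of [F] over the
    parallelogram spanned by [t *: e_ j] and [t *: e_ k]. *)
Lemma schwarz F j k :
    (forall y, derivable F y (e_ j)) -> (forall y, derivable F y (e_ k)) ->
    (forall y, derivable ('D_(e_ j) F) y (e_ k)) ->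
    (forall y, derivable ('D_(e_ k) F) y (e_ j)) ->
    continuous ('D_(e_ k) ('D_(e_ j) F)) -> continuous ('D_(e_ j) ('D_(e_ k) F)) ->
  'D_(e_ k) ('D_(e_ j) F) = 'D_(e_ j) ('D_(e_ k) F).
Proof.
move=> dj dk djk dkj cjk ckj; apply/funext => y.
(* The mean value inequality is used twice: along [e_ q] for the first derivative of [F], which
   controls the derivative of the difference [G], then along [e_ p] for [G] itself. *)
have est p q : (forall y, derivable F y (e_ p)) ->
    (forall y, derivable ('D_(e_ p) F) y (e_ q)) ->
    continuous ('D_(e_ q) ('D_(e_ p) F)) ->
    forall e : K, 0 < e -> exists2 d : K, 0 < d & forall t, `|t| < d ->
     `|F (y + t *: e_ p + t *: e_ q) - F (y + t *: e_ p) - (F (y + t *: e_ q) - F y)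
       - 'D_(e_ q) ('D_(e_ p) F) y * t * t| <= e * `|t| * `|t|.
  move=> dp dpq cpq e e0; have [d d0 dP] := continuous_ball (cpq y) e0.
  (* The point of evaluation is displaced along two directions, by less than half of [d] each. *)
  exists (d / 2) => [|t td]; first exact: divr_gt0.
  pose G z := F (z + t *: e_ q) - F z.
  have DG z : is_derive z (e_ p) G ('D_(e_ p) F (z + t *: e_ q) - 'D_(e_ p) F z).
    apply: is_deriveB; last exact: derivableP.
    have E : (fun h : K => h^-1 *: (F (h *: e_ p + z + t *: e_ q) - F (z + t *: e_ q))) =
         (fun h : K => h^-1 *: (F (h *: e_ p + (z + t *: e_ q)) - F (z + t *: e_ q))).
      by apply/funext => h; rewrite addrA.
    apply: DeriveDef; rewrite /derivable /derive /= E//; exact: dp.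
  have := @partial_mean_value G y p t ('D_(e_ q) ('D_(e_ p) F) y * t) (e * `|t|).
  apply=> [z|s st]; first exact: (@ex_derive _ _ _ _ _ _ _ (DG z)).
  rewrite (@derive_val _ _ _ _ _ _ _ (DG _)).
  apply: (@partial_mean_value ('D_(e_ p) F) (y + s *: e_ p) q t _ e dpq) => r rt; apply/ltW.
  rewrite -addrA; apply: dP; apply: le_lt_trans (ler_normD _ _) _.
  rewrite [d]splitr; apply: ltrD; apply: le_lt_trans (norm_delta_le _ _) _.
  - exact: le_lt_trans td.
  - exact: le_lt_trans td.
apply/eqP; rewrite -subr_eq0 -normr_eq0; apply/negPn/negP => ne0.
pose A : K := 'D_(e_ k) ('D_(e_ j) F) y; pose B : K := 'D_(e_ j) ('D_(e_ k) F) y.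
rewrite -/A -/B in ne0.
have alg (A' B' t p q r s : K) : (A' - B') * t * t =
  A' * t * t - (p - q - (r - s)) + (p - r - (q - s) - B' * t * t) by ring.
(* With a quarter for each estimate, the two errors add up to half of [|A - B| * d ^ 2], which is
   absurd if [A] and [B] differ. *)
have e0 : 0 < `|A - B| / 4 by rewrite divr_gt0// lt_def ne0 normr_ge0.
have [d1 d10 d1P] := est j k dj djk cjk _ e0.
have [d2 d20 d2P] := est k j dk dkj ckj _ e0.
have [d d0 [dd1 dd2]] : exists2 d, 0 < d & d < d1 /\ d < d2.
  (* Half the harmonic mean lies below both radii, without appeal to a total order on [K]. *)
  exists (d1 * d2 / (d1 + d2)); first by rewrite divr_gt0 ?mulr_gt0 ?addr_gt0.
  split; rewrite ltr_pdivrMr ?addr_gt0//.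
    by rewrite mulrDr ltrDr mulr_gt0.
  by rewrite mulrDr mulrC ltrDl mulr_gt0.
have nd : `|d| = d by rewrite gtr0_norm.
have := lerD (d1P d _) (d2P d _); rewrite nd => /(_ dd1 dd2) H.
have : `|(A - B) * d * d| <= `|A - B| / 2 * d * d.
  have -> : `|A - B| / 2 * d * d = `|A - B| / 4 * d * d + `|A - B| / 4 * d * d by field.
  apply: le_trans H; rewrite [X in _ <= X + _]distrC.
  apply: le_trans (ler_normD _ _); rewrite le_eqVlt; apply/orP; left; apply/eqP; congr `|_|.
  by rewrite (addrAC y (d *: e_ k)); exact: alg.
rewrite !normrM nd !ler_pM2r// ler_pdivlMr// mulr_natr mulr2n gerDl => le0.
by move: ne0; rewrite eq_le le0 normr_ge0.
Qed.

End MeanValue.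

(** * The chain rule *)

Section ChainRule.
Variables (K : numFieldType) (mvbK : mean_value_bound K) (m : nat).
Implicit Types (F : 'rV[K]_m -> K) (y z v : 'rV[K]_m) (l : 'I_m).

Let e_ l : 'rV[K]_m := delta_mx 0 l.

(** The points [y + trunc k v] form a staircase path from [y] to [y + v], with one coordinate
    direction per step. *)
Let trunc k v : 'rV[K]_m := \row_j (if (j < k)%N then v 0 j else 0).

Let truncS v l : trunc l.+1 v = trunc l v + v 0 l *: e_ l.
Proof.
apply/rowP => j; rewrite !mxE eqxx /= ltnS leq_eqVlt -(inj_eq val_inj).
by have [/val_inj ->|_] := eqVneq (j : nat) l; rewrite ?ltnn ?mulr1 ?add0r ?mulr0 ?addr0.
Qed.

Let norm_trunc k v (d : K) : 0 < d -> (forall j, `|v 0 j| < d) -> `|trunc k v| < d.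
Proof.
move=> d0 vd; have [->//|[j ->]] := norm_rowE (trunc k v).
by rewrite mxE; case: ifP; rewrite ?normr0.
Qed.

(** A step of length 0 receives the partial derivative, the expected limit, so that convergence
    holds even when entries of [v] vanish arbitrarily close to the limit. *)
Let quot F y v l : K :=
  if v 0 l == 0 then 'D_(e_ l) F y
  else (F (y + trunc l.+1 v) - F (y + trunc l v)) / v 0 l.

Let quotE F y v : F (y + v) - F y = \sum_(l < m) v 0 l * quot F y v l.
Proof.
have {1}-> : v = trunc m v by apply/rowP => j; rewrite mxE ltn_ord.
have {2}-> : y = y + trunc 0 v.
  by apply/rowP => j; rewrite !mxE addr0.
rewrite -(telescope_sumr (fun k => F (y + trunc k v))) // big_mkord.
apply: eq_bigr => l _; rewrite /quot truncS; case: eqVneq => [->|v0].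
  by rewrite scale0r addr0 subrr mul0r.
by rewrite mulrCA divff ?mulr1.
Qed.

Let quot_le F y v l (d e : K) :
    (forall y, derivable F y (e_ l)) -> 0 < d -> 0 < e ->
    (forall v, `|v| < d -> `|'D_(e_ l) F (y + v) - 'D_(e_ l) F y| < e) ->
    (forall j, `|v 0 j| < d / 2) ->
  `|'D_(e_ l) F y - quot F y v l| <= e.
Proof.
move=> dF d0 e0 le_e vd; rewrite /quot distrC; case: eqVneq => [_|v0].
  by rewrite subrr normr0 ltW.
rewrite truncS addrA.
have := @partial_mean_value K mvbK m F (y + trunc l v) l (v 0 l) ('D_(e_ l) F y) e dF.
rewrite -ler_pdivrMr ?normr_gt0// -normf_div mulrBl mulfK//; apply => t tv.
rewrite -addrA; apply/ltW/le_e; apply: le_lt_trans (ler_normD _ _) _.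
rewrite [d]splitr; apply: ltrD; first by apply: norm_trunc; rewrite ?divr_gt0.
exact: le_lt_trans (norm_delta_le _ _) (le_lt_trans tv (vd l)).
Qed.

(** The increment of [F] telescopes along the staircase into increments of the [g l] times the
    quotients [quot], which tend to the partial derivatives by [quot_le]. *)
Lemma is_derive_chain F (g : 'I_m -> K -> K) (x : K) :
    (forall l y, derivable F y (e_ l)) ->
    (forall l, continuous ('D_(e_ l) F)) ->
    (forall l, derivable (g l) x 1) ->
  is_derive x 1 (fun x => F (\row_l g l x))
    (\sum_l (g l)^`()%classic x * 'D_(e_ l) F (\row_l g l x)).
Proof.
move=> dF cF dg; set y := \row_l g l x.
pose v (h : K) : 'rV[K]_m := \row_l g l (h + x) - y.
have v0 l : v h 0 l @[h --> 0^'] --> (0 : K).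
  have /differentiable_continuous/cvgrPdist_lt cg : differentiable (g l) x.
    exact/derivable1_diffP.
  apply/cvgr0Pnorm_lt => e /cg /nbhs_ballP[d /= d0 dP].
  apply/nbhs_ballP; exists d => //= h; rewrite /ball /= sub0r normrN => hd _.
  rewrite !mxE distrC; apply: dP.
  by rewrite /ball /= opprD addrCA subrr addr0 normrN.
have cq l : quot F y (v h) l @[h --> 0^'] --> 'D_(e_ l) F y.
  apply/cvgrPdist_le => e e0; have [d d0 dP] := continuous_ball (cF l y) e0.
  have : \forall h \near 0^', forall j, `|v h 0 j| < d / 2.
    by apply: filter_forall => j; have /cvgr0Pnorm_lt := v0 j; apply; rewrite divr_gt0.
  by apply: filterS => h; exact: quot_le.
have cv : h^-1 *: (F (\row_l g l (h *: 1 + x)) - F y) @[h --> 0^'] -->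
    \sum_l (g l)^`()%classic x * 'D_(e_ l) F y.
  have -> : (fun h : K => h^-1 *: (F (\row_l g l (h *: 1 + x)) - F y)) =
     (fun h : K => \sum_l (h^-1 *: (g l (h *: 1 + x) - g l x)) * quot F y (v h) l).
    apply/funext => h; rewrite -[h *: 1]/(h * 1) mulr1.
    have -> : \row_l g l (h + x) = y + v h by rewrite /v (addrC y) subrK.
    rewrite quotE scaler_sumr; apply: eq_bigr => l _.
    by rewrite !mxE /GRing.scale /= mulrA.
  apply: cvg_big => [|l _]; first exact: add_continuous.
  apply: cvgM; last exact: cq.
  rewrite derive1E; exact: dg.
by apply: DeriveDef; [apply/cvg_ex; eexists; exact: cv|exact: cvg_lim cv].
Qed.

Lemma partialn_perm F : smooth_mv F ->
  forall s t, perm_eq s t -> partialn s F = partialn t F.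
Proof.
move=> sF; apply: seq_perm_ind => s1 a b s2.
elim: s1 => [|c s1 IH] /=; last by rewrite IH.
apply: schwarz => //.
- by move=> y; have [H _] := sF s2; apply: H.
- by move=> y; have [H _] := sF s2; apply: H.
- by move=> y; have [H _] := sF (b :: s2); apply: H.
- by move=> y; have [H _] := sF (a :: s2); apply: H.
- by have [_ H] := sF [:: a, b & s2].
- by have [_ H] := sF [:: b, a & s2].
Qed.

End ChainRule.

(** * Contractions of partial derivatives with derivatives of the inner functions *)

Lemma perm_cons2 (T : eqType) (a b : T) (s : seq T) :
  perm_eq [:: a, b & s] [:: b, a & s].
Proof. exact: (permEl (perm_catCA [:: a] [:: b] s)). Qed.

Section MultiSum.
Variables (K : numFieldType) (m : nat).
Implicit Types (W : nat -> 'I_m -> K) (s : seq nat) (Phi : seq 'I_m -> K).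

(** The list [s] holds the orders of derivation, with one summation index per entry. Recursion on a
    list lets the product rule be proved by induction; [multi_sum_indices] recovers the nested sums
    of the statement. *)
Fixpoint multi_sum W s Phi : K :=
  if s is a :: s' then \sum_l W a l * multi_sum W s' (fun ls => Phi (l :: ls))
  else Phi [::].

Definition perm_invariant Phi := forall ls ls', perm_eq ls ls' -> Phi ls = Phi ls'.

Lemma multi_sum_perm W Phi : perm_invariant Phi ->
  forall s t, perm_eq s t -> multi_sum W s Phi = multi_sum W t Phi.
Proof.
move=> PhiP s t st; have := @seq_perm_ind _ _ (fun s => multi_sum W s Phi) _ _ _ st.
apply=> s1 a b s2; elim: s1 Phi PhiP => [|c s1 IH] Phi PhiP /=.
  under eq_bigr do rewrite mulr_sumr; under [RHS]eq_bigr do rewrite mulr_sumr.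
  rewrite exchange_big /=; apply: eq_bigr => l _; apply: eq_bigr => k _.
  rewrite mulrCA; congr (_ * (_ * multi_sum _ _ _)); apply/funext => ls.
  by apply: PhiP; exact: perm_cons2.
apply: eq_bigr => l _; congr (_ * _); apply: IH => ls ls' E.
by apply: PhiP; rewrite perm_cons.
Qed.

Lemma is_derive_big (I : Type) (r : seq I) (P : pred I) (h : I -> K -> K) (dh : I -> K)
    (x : K) :
  (forall i, P i -> is_derive x (1 : K) (h i) (dh i)) ->
  is_derive x (1 : K) (fun x => \sum_(i <- r | P i) h i x) (\sum_(i <- r | P i) dh i).
Proof.
move=> dhP; elim: r => [|i r IH].
  under eq_fun do rewrite big_nil; rewrite big_nil; exact: is_derive_cst.
under eq_fun do rewrite big_cons; rewrite big_cons; case: ifP => // Pi.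
by apply: is_deriveD => //; exact: dhP.
Qed.

Lemma is_derive_mulf (u v : K -> K) (x du dv : K) :
  is_derive x (1 : K) u du -> is_derive x (1 : K) v dv ->
  is_derive x (1 : K) (fun x => u x * v x) (du * v x + u x * dv).
Proof.
move=> Hu Hv; have := @is_deriveM K K^o u v x 1 du dv Hu Hv.
by rewrite addrC /GRing.scale /= [X in X + _]mulrC.
Qed.

(* The derivative falls either on Phi, creating a factor of order 1, or on a factor of order a. *)
Lemma is_derive_multi_sum (W : nat -> 'I_m -> K -> K) (Phi : seq 'I_m -> K -> K) (x : K) :
    (forall a l, is_derive x (1 : K) (W a l) (W a.+1 l x)) ->
    (forall y, perm_invariant (Phi^~ y)) ->
    (forall ls, is_derive x (1 : K) (Phi ls) (\sum_l W 1 l x * Phi (l :: ls) x)) ->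
  forall s, is_derive x (1 : K) (fun y => multi_sum (fun a l => W a l y) s (Phi^~ y))
    (multi_sum (fun a l => W a l x) (1 :: s)%N (Phi^~ x) +
     \sum_(a <- s) multi_sum (fun a l => W a l x) (a.+1 :: rem a s) (Phi^~ x)).
Proof.
move=> dW PhiP dPhi s; elim: s Phi PhiP dPhi => [|b s IH] Phi PhiP dPhi.
  by rewrite big_nil addr0; exact: dPhi.
pose MS s l := multi_sum (fun a l => W a l x) s (fun ls => Phi (l :: ls) x).
have dMS l : is_derive x (1 : K)
   (fun y => multi_sum (fun a l => W a l y) s (fun ls => Phi (l :: ls) y))
   (MS (1 :: s)%N l + \sum_(a <- s) MS (a.+1 :: rem a s) l).
  apply: (IH (fun ls => Phi (l :: ls))) => [y ls ls' E|ls].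
    by apply: (PhiP y); rewrite perm_cons.
  apply: (is_derive_eq (dPhi (l :: ls))).
  apply: eq_bigr => k _; congr (_ * _); apply: PhiP; exact: perm_cons2.
have dsum := is_derive_big (index_enum 'I_m) (P := xpredT)
  (fun l _ => is_derive_mulf (dW b l) (dMS l)).
apply: (is_derive_eq dsum).
(* Deriving the head factor gives the term of the new head [b] in the sum, since [rem b (b :: s)] is
   [s]. *)
rewrite big_split /= big_cons /= eqxx addrCA; congr (_ + _).
under eq_bigr do rewrite mulrDr.
rewrite big_split /=; congr (_ + _).
  apply: (@multi_sum_perm (fun a l => W a l x) (Phi^~ x) (PhiP x) [:: b, 1 & s]%N [:: 1, b & s]%N).
  exact: perm_cons2.
under eq_bigr do rewrite mulr_sumr.
rewrite exchange_big /=; apply: eq_big_seq => a sa.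
apply: (@multi_sum_perm (fun a l => W a l x) (Phi^~ x) (PhiP x)
  [:: b, a.+1 & rem a s]%N (a.+1 :: rem a (b :: s))).
rewrite (permPl (perm_cons2 _ _ _)) /= perm_cons.
(* When [a = b], [rem] drops the head instead of a later occurrence, which leaves the same
   multiset. *)
by case: eqVneq => // ->; rewrite perm_sym perm_to_rem.
Qed.

Lemma multi_sum_tuple W s n Phi : size s = n ->
  multi_sum W s Phi =
  \sum_(t : n.-tuple 'I_m) Phi t * \prod_(p <- zip s t) W p.1 p.2.
Proof.
elim: s n Phi => [|a s IH] n Phi /= <-.
  rewrite (big_pred1 (nil_tuple 'I_m)) => [|t]; first by rewrite big_nil mulr1.
  by apply/esym/eqP/val_inj; rewrite [t]tuple0.
under eq_bigr do rewrite (IH (size s)) // mulr_sumr.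
rewrite pair_bigA /= [RHS](reindex (fun p => [tuple of p.1 :: tval p.2])) /=; last first.
  exists (fun t : (size s).+1.-tuple 'I_m => (thead t, [tuple of behead t])) => [[l t] _|t _].
    by rewrite theadE; congr (_, _); apply: val_inj.
  by rewrite [RHS]tuple_eta; apply: val_inj.
by apply: eq_bigr => -[l t] _ /=; rewrite big_cons /= mulrCA.
Qed.

End MultiSum.

Lemma zip_flatten (I T U : Type) (r : seq I) (a : I -> seq T) (b : I -> seq U) :
    (forall i, size (a i) = size (b i)) ->
  zip (flatten [seq a i | i <- r]) (flatten [seq b i | i <- r]) =
  flatten [seq zip (a i) (b i) | i <- r].
Proof. by move=> ab; elim: r => //= i r IH; rewrite zip_cat // IH. Qed.

Lemma multi_sum_indices (K : numFieldType) (m d kappa : nat) (W : nat -> 'I_m -> K)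
    (Phi : seq 'I_m -> K) (lam mu : {ffun 'I_d -> 'I_kappa.+1}) :
  multi_sum W (flatten [seq nseq (mu e) (lam e : nat) | e : 'I_d]) Phi =
  \sum_(l : indices m mu) Phi (indices_seq l) *
     \prod_(e < d) \prod_(nu < mu e) W (lam e) (tnth (l e) nu).
Proof.
have sz (l : indices m mu) : size (indices_seq l) == (\sum_(e < d) mu e)%N.
  rewrite size_flatten /shape -map_comp sumnE big_map big_enum /=.
  by apply/eqP/eq_bigr => e _; rewrite size_tuple.
rewrite (@multi_sum_tuple _ _ _ _ (\sum_(e < d) mu e)%N); last first.
  rewrite size_flatten /shape -map_comp sumnE big_map big_enum /=.
  by apply: eq_bigr => e _; rewrite size_nseq.
rewrite (reindex (fun l => Tuple (sz l))) /=; last first.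
  (* Concatenation is injective because the lengths of the pieces are prescribed, and both types
     have [m] to the power [\sum_e mu e] elements. *)
  apply/onW_bij/inj_card_bij => [l l' /(congr1 val) /= E|].
    have /eq_in_map ll' : [seq tval (l e) | e : 'I_d] = [seq tval (l' e) | e : 'I_d].
      apply: eq_from_flatten_shape => //; rewrite /shape -!map_comp.
      by apply: eq_map => e /=; rewrite !size_tuple.
    by apply/ffunP => e; apply/val_inj/ll'; rewrite mem_enum.
  rewrite card_tuple card_ord /indices card_dep_ffun foldrE big_map big_enum /=.
  rewrite expn_sum; apply/eq_leq/eq_bigr => e _.
  have := card_tuple (mu e) 'I_m; rewrite card_ord; exact.
apply: eq_bigr => l _; congr (_ * _).
rewrite zip_flatten => [|e]; last by rewrite size_nseq size_tuple.
rewrite big_flatten big_map big_enum /=; apply: eq_bigr => e _.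
have -> : zip (nseq (mu e) (lam e : nat)) (l e) = [seq (lam e : nat, k) | k <- l e].
  case: (l e) => t /= /eqP <-; by elim: t => //= k t ->.
by rewrite big_map big_tuple.
Qed.

(** * Partitions as multiplicity functions *)

(** Reindexing along a bijection given as a relation, for correspondences awkward to write as total
    functions; both sides equal a double sum over the related pairs. *)
Lemma big_rel_bij (V : nmodType) (I J : finType) (P : pred I) (Q : pred J) (R : I -> J -> bool)
    (F : I -> V) (G : J -> V) :
    (forall i, P i -> exists2 j, Q j & R i j) ->
    (forall j, Q j -> exists2 i, P i & R i j) ->
    (forall i j j', P i -> Q j -> Q j' -> R i j -> R i j' -> j = j') ->
    (forall i i' j, P i -> P i' -> Q j -> R i j -> R i' j -> i = i') ->
    (forall i j, P i -> Q j -> R i j -> F i = G j) ->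
  \sum_(i | P i) F i = \sum_(j | Q j) G j.
Proof.
move=> exJ exI uJ uI FG.
transitivity (\sum_(i | P i) \sum_(j | Q j && R i j) F i).
  apply: eq_bigr => i Pi; have [j Qj Rij] := exJ i Pi.
  rewrite (big_pred1 j) // => j' /=; apply/andP/eqP => [[Qj' Rij']|-> //].
  exact: (uJ i).
rewrite (exchange_big_dep Q) /= => [|i j _ /andP[]//].
apply: eq_bigr => j Qj; have [i Pi Rij] := exI j Qj.
rewrite (big_pred1 i) => [|i' /=]; first exact: FG.
rewrite Qj /=; apply/andP/eqP => [[Pi' Rij']|-> //]; exact: (uI _ _ j).
Qed.

Section Profiles.
Variable N : nat.
Implicit Types (c : {ffun 'I_N.+1 -> 'I_N.+1}) (i n : nat).

(* A profile c is the partition with c i blocks of size i. The pair (lambda, mu) of the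
   statement consists of the support of c and of the values of c on it. *)
Definition prof_ok n c := (c ord0 == 0 :> nat) && (\sum_(k < N.+1) c k * k == n)%N.
Definition prof_denom c := (\prod_(k < N.+1) (k`! ^ c k * (c k)`!))%N.
Definition blocks c : seq nat := flatten [seq nseq (c k) (k : nat) | k : 'I_N.+1].

(** One block of size [i] grows to size [i.+1]. Additions on both sides avoid truncated subtraction;
    because of [0 < k], nothing is removed when [i = 0], and a block of size 1 is created. *)
Definition promote i c c' := [forall k : 'I_N.+1,
  c' k + ((k == i :> nat) && (0 < k)) == c k + (k == i.+1 :> nat)]%N.

(* The number of ways of enlarging a block of size i, where a block of size 0 stands for a
   new block. *)
Definition prof_mult i c := if i == 0%N then 1%N else (c (inord i) : nat).

Lemma big_ord_only (T : Type) (idx : T) (op : Monoid.com_law idx) i (F : nat -> T) :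
  (i <= N)%N -> \big[op/idx]_(k < N.+1) (if k == i :> nat then F k else idx) = F i.
Proof.
move=> iN; rewrite -big_mkcond (big_pred1 (inord i)) ?inordK // => k.
by rewrite /= -(inj_eq val_inj) /= inordK.
Qed.

(** The weight bounds the multiplicity of every positive size by [N], so the values fit in the
    finite type; the weight does not see size 0, whence the first hypothesis. *)
Lemma prof_exists (a : nat -> nat) : a 0%N = 0%N -> (\sum_(k < N.+1) a k * k <= N)%N ->
  exists c, forall k : 'I_N.+1, c k = a k :> nat.
Proof.
move=> a0 aN; exists [ffun k : 'I_N.+1 => inord (a k)] => k; rewrite ffunE inordK // ltnS.
have [k0|k0] := posnP k; first by rewrite k0 a0.
apply: leq_trans aN; rewrite (bigD1 k) //= (leq_trans _ (leq_addr _ _)) //.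
by rewrite leq_pmulr.
Qed.

Lemma count_blocks c (x : 'I_N.+1) : count_mem (x : nat) (blocks c) = c x.
Proof.
rewrite count_flatten -map_comp sumnE big_map big_enum /=.
rewrite (eq_bigr (fun k : 'I_N.+1 => if k == x :> nat then c (inord k) : nat else 0%N)).
  by rewrite (big_ord_only _ (fun k => c (inord k) : nat)) ?inord_val // -ltnS.
move=> k _ /=; rewrite count_nseq /= inord_val; by case: eqP; rewrite ?mul1n.
Qed.

Lemma blocks_le c x : x \in blocks c -> (x <= N)%N.
Proof.
move=> /flattenP[s /mapP[k _ ->]]; rewrite mem_nseq => /andP[_ /eqP ->].
by rewrite -ltnS.
Qed.

(** * Enlarging one block of a partition *)

Lemma promoteP i c c' : promote i c c' -> forall k : 'I_N.+1,
  (c' k + ((k == i :> nat) && (0 < k)) = c k + (k == i.+1 :> nat))%N.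
Proof. by move=> /forallP H k; exact/eqP. Qed.

Lemma weight_shift (a b : nat -> nat) i : (i < N)%N ->
    (forall k : 'I_N.+1,
       a k + ((k == i :> nat) && (0 < k)) = b k + (k == i.+1 :> nat))%N ->
  (\sum_(k < N.+1) a k * k = (\sum_(k < N.+1) b k * k).+1)%N.
Proof.
move=> iN ab.
have : (\sum_(k < N.+1) (a k + ((k == i :> nat) && (0 < k))) * k =
        \sum_(k < N.+1) (b k + (k == i.+1 :> nat)) * k)%N.
  by apply: eq_bigr => k _; rewrite ab.
under eq_bigr do rewrite mulnDl; under [RHS]eq_bigr do rewrite mulnDl.
rewrite !big_split /=.
have only j (p : nat -> bool) : (j <= N)%N -> (forall k, (0 < k)%N -> p k = (k == j)) ->
    (\sum_(k < N.+1) p k * k = j)%N.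
  move=> jN pE; rewrite -[RHS](big_ord_only addn id jN); apply: eq_bigr => k _.
  have [->|k0] := posnP k; first by rewrite muln0 if_same.
  by rewrite pE //; case: eqP; rewrite ?mul1n.
rewrite (only i (fun k => (k == i) && (0 < k))%N) ?(ltnW iN)//; last by move=> k ->; rewrite andbT.
rewrite (only i.+1 (fun k => k == i.+1)) //; lia.
Qed.

Lemma prof_le n c (k : 'I_N.+1) : prof_ok n c -> (c k * k <= n)%N.
Proof. by case/andP=> _ /eqP <-; rewrite (bigD1 k) //= leq_addr. Qed.

Lemma promote_ex_target n i c : (n < N)%N -> (i < N)%N -> prof_ok n c -> (0 < prof_mult i c)%N ->
  exists2 c', prof_ok n.+1 c' & promote i c c'.
Proof.
move=> nN iN ok_c m0; have [/eqP c0 /eqP wc] := andP ok_c.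
(* The subtraction is exact: for [i > 0], [m0] provides a block of size [i]. *)
pose a k : nat := (c (inord k) + (k == i.+1) - ((k == i) && (0 < k)))%N.
pose b k : nat := c (inord k).
have ab (k : 'I_N.+1) : (a k + ((k == i :> nat) && (0 < k)) = b k + (k == i.+1 :> nat))%N.
  rewrite /a /b; move: m0; rewrite /prof_mult.
  case: (k =P i :> nat) => [<-|_] /=; last by rewrite subn0 addn0.
  by rewrite inord_val; case: (posnP k) => [-> _|k0] /=; lia.
have bc : (\sum_(k < N.+1) b k * k = n)%N.
  by rewrite -wc; apply: eq_bigr => k _; rewrite /b inord_val.
have wa := weight_shift iN ab; rewrite bc in wa.
have a0 : a 0%N = 0%N.
  have -> : a 0%N = a (ord0 : 'I_N.+1) by [].
  by have := ab ord0; rewrite {1}/b inord_val /= andbF c0 !addn0.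
have [|c' c'E] := prof_exists a0; first by rewrite wa.
exists c'.
  rewrite /prof_ok c'E a0 eqxx /= -wa; apply/eqP/eq_bigr => k _; by rewrite c'E.
by apply/forallP => k; rewrite c'E ab /b inord_val.
Qed.

Lemma promote_ex_source n i c' : (n < N)%N -> (i < N)%N -> prof_ok n.+1 c' ->
    (0 < c' (inord i.+1))%N ->
  exists2 c, prof_ok n c & promote i c c'.
Proof.
move=> nN iN ok_c m0; have [/eqP c0 /eqP wc] := andP ok_c.
pose b k : nat := (c' (inord k) + ((k == i) && (0 < k)) - (k == i.+1))%N.
pose a k : nat := c' (inord k).
have ab (k : 'I_N.+1) : (a k + ((k == i :> nat) && (0 < k)) = b k + (k == i.+1 :> nat))%N.
  rewrite /a /b; case: (k =P i.+1 :> nat) => [E|_] /=; last by rewrite subn0 addn0.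
  by rewrite E; lia.
have ac : (\sum_(k < N.+1) a k * k = n.+1)%N.
  by rewrite -wc; apply: eq_bigr => k _; rewrite /a inord_val.
have wb := weight_shift iN ab; rewrite ac in wb; case: wb => wb.
have b0 : b 0%N = 0%N.
  have -> : b 0%N = b (ord0 : 'I_N.+1) by [].
  by have := ab ord0; rewrite {1}/a inord_val /= andbF c0 !addn0.
have [|c cE] := prof_exists b0; first by rewrite -wb ltnW.
exists c.
  rewrite /prof_ok cE b0 eqxx /= wb; apply/eqP/eq_bigr => k _; by rewrite cE.
by apply/forallP => k; rewrite cE -ab /a inord_val.
Qed.

(** Only the factors at [i] and [i.+1] change: for [i > 0] the first is divided by [i! c_i], the
    second is multiplied by [(i+1)! c'_(i+1)], and the factorials leave [i + 1]. *)
Lemma promote_denom n i c c' : (i < N)%N -> prof_ok n c -> promote i c c' ->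
  (prof_denom c' * prof_mult i c = i.+1 * c' (inord i.+1) * prof_denom c)%N.
Proof.
move=> iN /andP[/eqP c0 _] /promoteP cc'.
pose A := (\prod_(k < N.+1) if k == i :> nat then i`! * prof_mult i c else 1)%N.
pose B := (\prod_(k < N.+1) if k == i.+1 :> nat then (i.+1)`! * c' (inord i.+1) else 1)%N.
have : (prof_denom c' * A = prof_denom c * B)%N.
  rewrite /A /B /prof_denom -!big_split /=; apply: eq_bigr => k _; have := cc' k.
  case: (k =P i :> nat) => [ki|_] /=.
    rewrite -ki; case: eqP => [|_]; first by lia.
    rewrite addn0 muln1 /prof_mult; have [k0|k0] := posnP k.
      by rewrite addn0 => ->; rewrite k0 fact0 !muln1.
    rewrite addn1 inord_val => <-; rewrite factS expnS; lia.
  rewrite addn0; case: eqP => [<-|_]; last by rewrite addn0 => ->.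
  by rewrite addn1 inord_val muln1 => ->; rewrite factS expnS; lia.
rewrite /A /B (big_ord_only _ (fun=> i`! * prof_mult i c)%N (ltnW iN)).
rewrite (big_ord_only _ (fun=> (i.+1)`! * c' (inord i.+1))%N iN) factS.
have := fact_gt0 i; nia.
Qed.

Lemma promote_perm n i c c' : (i < N)%N -> prof_ok n c -> promote i c c' ->
  perm_eq (blocks c') (i.+1 :: rem i (blocks c)).
Proof.
move=> iN /andP[/eqP c0 _] /promoteP cc'; apply/allP => x _ /=; apply/eqP.
rewrite count_mem_rem; have [xN|xN] := leqP x N.
  pose k := Ordinal (xN : x < N.+1)%N; have := cc' k.
  rewrite -(count_blocks c') -(count_blocks c) /=.
  rewrite [x == i]eq_sym [x == i.+1]eq_sym.
  have [x0|x0] := posnP x; last by lia.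
  rewrite andbF -[x in count_mem x (blocks c)]/(k : nat) count_blocks.
  have -> : k = ord0 by apply: val_inj.
  by rewrite c0; lia.
rewrite !(count_memPn _); first by case: eqP; lia.
- by apply/negP => /blocks_le; lia.
- by apply/negP => /blocks_le; lia.
Qed.

Lemma promote_inj_target i c c1 c2 : promote i c c1 -> promote i c c2 -> c1 = c2.
Proof.
move=> /promoteP H1 /promoteP H2; apply/ffunP => k; apply: val_inj => /=.
by have := H1 k; have := H2 k; lia.
Qed.

Lemma promote_inj_source i c c1 c2 : promote i c1 c -> promote i c2 c -> c1 = c2.
Proof.
move=> /promoteP H1 /promoteP H2; apply/ffunP => k; apply: val_inj => /=.
by have := H1 k; have := H2 k; lia.
Qed.

Lemma promote_gt0 i c c' : (i < N)%N -> promote i c c' ->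
  ((0 < prof_mult i c) && (0 < c' (inord i.+1)))%N.
Proof.
move=> iN /promoteP cc'; rewrite /prof_mult; apply/andP; split.
  have iE : (inord i : 'I_N.+1) = i :> nat by rewrite inordK // ltnW.
  by have := cc' (inord i); rewrite iE; case: (posnP i) => [->//|i0]; lia.
have iE : (inord i.+1 : 'I_N.+1) = i.+1 :> nat by rewrite inordK.
by have := cc' (inord i.+1); rewrite iE; lia.
Qed.

(** * The recursion satisfied by the weights *)

Lemma prof_denom_gt0 c : (0 < prof_denom c)%N.
Proof. by apply: prodn_gt0 => k; rewrite muln_gt0 expn_gt0 !fact_gt0. Qed.

Lemma prof_weight n c : prof_ok n c -> (\sum_(i < N) i.+1 * c (inord i.+1) = n)%N.
Proof.
case/andP => _ /eqP <-; rewrite big_ord_recl muln0 add0n.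
apply: eq_bigr => i _; rewrite mulnC; congr (c _ * _)%N.
by apply: val_inj; rewrite /= inordK // ltnS.
Qed.

Lemma sum_blocks (V : nmodType) n c (X : nat -> V) : (n < N)%N -> prof_ok n c ->
  X 0%N + \sum_(a <- blocks c) X a = \sum_(i < N) X i *+ prof_mult i c.
Proof.
move=> nN ok_c; have [/eqP c0 _] := andP ok_c.
rewrite big_flatten big_map big_enum /=.
(* A block of size [N] would exceed the total weight [n < N]. *)
rewrite big_ord_recr /= (_ : c ord_max = ord0); last first.
  by apply: val_inj => /=; have := prof_le ord_max ok_c; rewrite /=; nia.
rewrite big_nil addr0.
under eq_bigr do rewrite big_nseq iter_addr_0.
have N0 : (0 < N)%N by exact: leq_ltn_trans nN.
rewrite (bigD1 (Ordinal N0)) //= [RHS](bigD1 (Ordinal N0)) //= mulr1n.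
have -> : widen_ord (leqnSn N) (Ordinal N0) = ord0 by apply: val_inj.
rewrite c0 mulr0n add0r; congr (_ + _); apply: eq_bigr => i i0.
rewrite /prof_mult ifF; last exact/negbTE.
by congr (X _ *+ c _); apply: val_inj; rewrite /= inordK // ltnS ltnW.
Qed.

(** The sum over pairs of a partition [c] and a size [i] is reindexed by [promote i]. By
    [promote_denom] the coefficient becomes [n! (i+1) c'_(i+1)] over the denominator of [c'], and
    summing over [i] yields [n! (n+1)] by [prof_weight]. *)
Lemma prof_step (K : numFieldType) n (X : seq nat -> K) : (n < N)%N ->
    (forall s t, perm_eq s t -> X s = X t) ->
  \sum_(c | prof_ok n c) (n`!)%:R / (prof_denom c)%:R *
     (X (1 :: blocks c)%N + \sum_(a <- blocks c) X (a.+1 :: rem a (blocks c))) =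
  \sum_(c | prof_ok n.+1 c) ((n.+1)`!)%:R / (prof_denom c)%:R * X (blocks c).
Proof.
move=> nN XP.
have denom0 c : (prof_denom c)%:R != 0 :> K by rewrite pnatr_eq0 -lt0n prof_denom_gt0.
transitivity (\sum_(c | prof_ok n c) \sum_(i < N) (n`!)%:R / (prof_denom c)%:R *
    (X (i.+1 :: rem (i : nat) (blocks c)) *+ prof_mult i c)).
  apply: eq_bigr => c ok_c; rewrite -mulr_sumr; congr (_ * _).
  rewrite -(sum_blocks (fun a => X (a.+1 :: rem a (blocks c))) nN ok_c).
  (* For [i = 0], [rem 0] changes nothing, as no block has size 0. *)
  rewrite rem_id //; apply/count_memPn; have [/eqP c0 _] := andP ok_c.
  by rewrite -[RHS]c0 -count_blocks.
transitivity (\sum_(c | prof_ok n.+1 c) \sum_(i < N) (n`!)%:R / (prof_denom c)%:R *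
    (X (blocks c) *+ (i.+1 * c (inord i.+1)))); last first.
  apply: eq_bigr => c ok_c; rewrite -mulr_sumr sumrMnr (prof_weight ok_c).
  by rewrite factS natrM -mulr_natl; ring.
rewrite exchange_big [RHS]exchange_big /=; apply: eq_bigr => i _.
(* Terms with coefficient 0 have no partner under [promote i] and are discarded on both sides. *)
rewrite (bigID (fun c => 0 < prof_mult i c)%N) /= [X in _ + X]big1 ?addr0; last first.
  by move=> c /andP[_]; rewrite -eqn0Ngt => /eqP ->; rewrite mulr0.
rewrite [RHS](bigID (fun c => 0 < c (inord i.+1))%N) /= [X in _ + X]big1 ?addr0; last first.
  by move=> c /andP[_]; rewrite -eqn0Ngt => /eqP ->; rewrite muln0 mulr0.
apply: (big_rel_bij (R := promote i)).
- move=> c /andP[ok_c m0]; have [c' ok_c' cc'] := promote_ex_target nN (ltn_ord i) ok_c m0.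
  by exists c' => //; rewrite ok_c'; case/andP: (promote_gt0 (ltn_ord i) cc').
- move=> c' /andP[ok_c' m0]; have [c ok_c cc'] := promote_ex_source nN (ltn_ord i) ok_c' m0.
  by exists c => //; rewrite ok_c; case/andP: (promote_gt0 (ltn_ord i) cc').
- by move=> c c1 c2 _ _ _; exact: promote_inj_target.
- by move=> c1 c2 c _ _ _; exact: promote_inj_source.
- move=> c c' /andP[ok_c _] _ cc'.
  rewrite (XP _ _ (promote_perm (ltn_ord i) ok_c cc')).
  have /(congr1 (fun k => k%:R : K)) := promote_denom (ltn_ord i) ok_c cc'.
  rewrite -[X _ *+ prof_mult _ _]mulr_natl -[X _ *+ (_ * _)]mulr_natl !natrM.
  move: (X _) (denom0 c) (denom0 c'); move: ((prof_denom c)%:R : K) ((prof_denom c')%:R : K).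
  move: ((prof_mult i c)%:R : K) (i.+1%:R : K) ((c' (inord i.+1))%:R : K) ((n`!)%:R : K).
  move=> p q r f dc dc' y dc0 dc0' E; rewrite !mulrA; congr (_ * y).
  apply: (mulfI dc0); apply: (mulfI dc0').
  transitivity (f * (dc' * p)); first by field.
  by rewrite E; field.
Qed.
End Profiles.

(** * Integrality of the coefficients *)

(** The quotient counts the partitions of a set of [b * a] elements into [b] blocks of size [a]. The
    binomial coefficient in the induction step counts the choices for the block of a given
    element. *)
Lemma dvdn_fact_expn a b : (0 < a)%N -> (a`! ^ b * b`! %| (b * a)`!)%N.
Proof.
case: a => // a _; elim: b => [|b IH]; first by rewrite dvd1n.
have E : (b.+1 * 'C((b.+1 * a.+1).-1, a) = 'C(b.+1 * a.+1, a.+1))%N.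
  have := mul_bin_diag (b.+1 * a.+1) a => H.
  by apply/eqP; rewrite -(eqn_pmul2l (ltn0Sn a)) -H; apply/eqP; lia.
have le : (a.+1 <= b.+1 * a.+1)%N by rewrite leq_pmull.
rewrite -(bin_fact le) -E (_ : b.+1 * a.+1 - a.+1 = b * a.+1)%N; last by lia.
have [q ->] := dvdnP IH; rewrite expnS [b.+1`!]factS.
apply/dvdnP; exists ('C((b.+1 * a.+1).-1, a) * q)%N.
move: (a.+1`! ^ b)%N (a.+1`!) (b`!) 'C(_, _) => u v w z; lia.
Qed.

(** The quotient is a multinomial coefficient. *)
Lemma dvdn_prod_fact (I : Type) (r : seq I) (n : I -> nat) :
  (\prod_(i <- r) (n i)`! %| (\sum_(i <- r) n i)`!)%N.
Proof.
elim: r => [|i r IH]; first by rewrite !big_nil.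
rewrite !big_cons -(bin_fact (leq_addr (\sum_(j <- r) n j)%N (n i))) addKn.
by rewrite dvdn_mull // dvdn_mul.
Qed.

Lemma fdb_denom_dvd kappa d (lam mu : {ffun 'I_d -> 'I_kappa.+1}) :
  lambda_ok lam -> mu_ok lam mu -> (fdb_denom lam mu %| kappa`!)%N.
Proof.
move=> /andP[/forallP lam0 _] /andP[_ /eqP weight].
have := dvdn_prod_fact (index_enum 'I_d) (fun e => mu e * lam e)%N.
rewrite weight; apply: dvdn_trans.
by apply: (big_ind2 (fun a b => a %| b)%N) => // [*|e _]; [exact: dvdn_mul|exact: dvdn_fact_expn].
Qed.

(** * From multiplicity functions to the pairs (lambda, mu) *)

Section Support.
Variable N : nat.
Implicit Types (c : {ffun 'I_N.+1 -> 'I_N.+1}).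

Definition supp c := [pred k : 'I_N.+1 | (0 < c k)%N].

Lemma supp_big (T : Type) (idx : T) (op : Monoid.com_law idx) c d (lam : {ffun 'I_d -> 'I_N.+1})
    (F : 'I_N.+1 -> nat -> T) : codom lam = enum (supp c) -> (forall k, F k 0%N = idx) ->
  \big[op/idx]_k F k (c k) = \big[op/idx]_(e < d) F (lam e) (c (lam e)).
Proof.
move=> lamE F0; transitivity (\big[op/idx]_(k in supp c) F k (c k)).
  rewrite [RHS]big_mkcond; apply: eq_bigr => k _; rewrite inE.
  by case: posnP => [->|//]; exact: F0.
by rewrite -big_enum -lamE big_map big_enum.
Qed.

Lemma enum_sorted (A : pred 'I_N.+1) : sorted ltn [seq val k | k <- enum A].
Proof.
rewrite sorted_map {1}/enum_mem sorted_filter //; first by move=> x y z; exact: ltn_trans.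
by rewrite -sorted_map -enumT val_enum_ord iota_ltn_sorted.
Qed.

Lemma codom_sorted d (lam : {ffun 'I_d -> 'I_N.+1}) :
  lambda_ok lam -> sorted ltn [seq val k | k <- codom lam].
Proof.
move=> /andP[_ /forallP lam_lt]; rewrite -map_comp sorted_map.
have : sorted (relpre val ltn) (enum 'I_d).
  by rewrite -sorted_map val_enum_ord iota_ltn_sorted.
by apply: sub_sorted => e1 e2 /=; have /forallP/(_ e2)/implyP := lam_lt e1.
Qed.

(** Since [enum] is increasing, the first condition also forces [p.1] to be strictly increasing. *)
Definition lists_prof d c (p : {ffun 'I_d -> 'I_N.+1} * {ffun 'I_d -> 'I_N.+1}) :=
  (codom p.1 == enum (supp c)) && [forall e, p.2 e == c (p.1 e)].

Lemma lists_profP d c (p : {ffun 'I_d -> 'I_N.+1} * {ffun 'I_d -> 'I_N.+1}) :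
  lists_prof c p -> codom p.1 = enum (supp c) /\ forall e, c (p.1 e) = p.2 e.
Proof. by case/andP => /eqP ? /forallP H; split=> // e; apply/esym/eqP. Qed.

Lemma lists_prof_denom d c (p : {ffun 'I_d -> 'I_N.+1} * {ffun 'I_d -> 'I_N.+1}) :
  lists_prof c p -> fdb_denom p.1 p.2 = prof_denom c.
Proof.
move=> /lists_profP[lamE muE].
rewrite /prof_denom (supp_big _ (F := fun (k : 'I_N.+1) n => k`! ^ n * n`!)%N lamE) //.
by apply: eq_bigr => e _; rewrite muE.
Qed.

Lemma lists_prof_weight d c (p : {ffun 'I_d -> 'I_N.+1} * {ffun 'I_d -> 'I_N.+1}) :
  lists_prof c p -> (\sum_(e < d) p.2 e * p.1 e = \sum_(k < N.+1) c k * k)%N.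
Proof.
move=> /lists_profP[lamE muE].
rewrite (supp_big _ (F := fun (k : 'I_N.+1) n => n * k)%N lamE) //.
by apply: eq_bigr => e _; rewrite muE.
Qed.

Lemma lists_prof_blocks d c (p : {ffun 'I_d -> 'I_N.+1} * {ffun 'I_d -> 'I_N.+1}) :
  lists_prof c p ->
  perm_eq (blocks c) (flatten [seq nseq (p.2 e) (p.1 e : nat) | e : 'I_d]).
Proof.
move=> /lists_profP[lamE muE]; apply/allP => x _ /=; apply/eqP.
rewrite !count_flatten -!map_comp !sumnE !big_map /=.
rewrite (supp_big _ (F := fun (k : 'I_N.+1) n => count_mem x (nseq n (k : nat))) lamE) //.
by apply: eq_bigr => e _; rewrite muE.
Qed.

Lemma lists_ex_prof n d (p : {ffun 'I_d -> 'I_N.+1} * {ffun 'I_d -> 'I_N.+1}) :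
    lambda_ok p.1 -> [forall e, 0 < p.2 e]%N -> (\sum_(e < d) p.2 e * p.1 e = n)%N ->
  exists2 c, prof_ok n c && (#|supp c| == d) & lists_prof c p.
Proof.
move: p => [lam mu] /= ok_lam /forallP mu0 weight.
have lam_inj : injective lam.
  apply/injectiveP; rewrite /injectiveb /dinjectiveb -(map_inj_uniq val_inj).
  by apply: sorted_uniq (codom_sorted ok_lam); [exact: ltn_trans|exact: ltnn].
pose c := [ffun k => if [pick e | lam e == k] is Some e then mu e else ord0 : 'I_N.+1].
have cE e : c (lam e) = mu e.
  rewrite ffunE; case: pickP => [e' /eqP/lam_inj -> //|/(_ e)]; by rewrite eqxx.
have suppE k : (k \in supp c) = (k \in codom lam).
  rewrite inE; apply/idP/idP => [|/codomP[e ->]]; last by rewrite cE.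
  by rewrite ffunE; case: pickP => // e /eqP <- _; exact: codom_f.
(* Two strictly increasing lists with the same elements coincide. *)
have lamE : codom lam = enum (supp c).
  apply: (inj_map val_inj); apply: (irr_sorted_eq ltn_trans ltnn).
  - exact: codom_sorted.
  - exact: enum_sorted.
  by apply: eq_mem_map => k; rewrite mem_enum suppE.
have cp : lists_prof c (lam, mu).
  by rewrite /lists_prof lamE eqxx; apply/forallP => e; rewrite cE.
exists c => //; rewrite /prof_ok -(lists_prof_weight cp) weight eqxx andbT.
rewrite cardE -lamE size_codom card_ord eqxx andbT.
apply: contraT; rewrite -lt0n => c0.
have : ord0 \in codom lam by rewrite -suppE inE.
case/codomP => e e0; have /andP[/forallP/(_ e)] := ok_lam.
by rewrite -e0.
Qed.

Lemma prof_ex_lists n d c : prof_ok n c -> #|supp c| = d ->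
  exists p : {ffun 'I_d -> 'I_N.+1} * {ffun 'I_d -> 'I_N.+1},
   [/\ lambda_ok p.1, [forall e, 0 < p.2 e]%N & lists_prof c p].
Proof.
move=> /andP[/eqP c0 _] cd.
pose lam := [ffun e : 'I_d => nth ord0 (enum (supp c)) e].
pose mu := [ffun e => c (lam e)].
have sz : size (enum (supp c)) = d by rewrite -cardE.
have lamE : codom lam = enum (supp c).
  apply: (@eq_from_nth _ ord0) => [|i]; rewrite size_codom card_ord ?sz // => id.
  have -> : nth ord0 (codom lam) i = lam (Ordinal id).
    rewrite (nth_map (Ordinal id)) ?size_enum_ord //.
    by rewrite -[X in nth _ _ X]/(val (Ordinal id)) nth_ord_enum.
  by rewrite ffunE.
have lamP e : (0 < c (lam e))%N.
  by have : lam e \in supp c by rewrite -mem_enum -lamE codom_f.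
exists (lam, mu); split => /=.
- apply/andP; split; apply/forallP => e.
    rewrite lt0n; apply: contraTneq (lamP e) => e0.
    by rewrite (_ : lam e = ord0) ?c0 //; exact: val_inj.
  apply/forallP => e'; apply/implyP => ee'.
  have := sorted_ltn_nth ltn_trans 0%N (enum_sorted (supp c)).
  move=> /(_ e e'); rewrite !inE size_map sz => /(_ (ltn_ord _) (ltn_ord _) ee').
  by rewrite !(nth_map ord0) ?sz // !ffunE.
- by apply/forallP => e; rewrite ffunE.
- by rewrite /lists_prof /= lamE eqxx; apply/forallP => e; rewrite ffunE.
Qed.

(** The condition on [mu] is that of [mu_ok] with a total [n] independent of the bound [N]. For
    fixed [d], [lists_prof] matches the pairs bijectively with the partitions having [d] distinct
    block sizes. *)
Lemma sum_profiles (V : nmodType) n d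
    (F : {ffun 'I_N.+1 -> 'I_N.+1} -> V)
    (G : {ffun 'I_d -> 'I_N.+1} -> {ffun 'I_d -> 'I_N.+1} -> V) :
    (forall c p, lists_prof c p -> G p.1 p.2 = F c) ->
  \sum_(lam : {ffun 'I_d -> 'I_N.+1} | lambda_ok lam)
    \sum_(mu : {ffun 'I_d -> 'I_N.+1} |
        [forall e, (0 < mu e)%N] && (\sum_(e < d) mu e * lam e == n)%N) G lam mu =
  \sum_(c | prof_ok n c && (#|supp c| == d)) F c.
Proof.
move=> FG; rewrite pair_big_dep /=.
apply: (big_rel_bij (R := fun p c => lists_prof c p)).
- by move=> p /and3P[ok_lam mu0 /eqP w]; exact: lists_ex_prof.
- move=> c /andP[ok_c /eqP cd]; have [p [ok_lam mu0 cp]] := prof_ex_lists ok_c cd.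
  exists p => //; rewrite ok_lam mu0 (lists_prof_weight cp).
  by case/andP: ok_c.
- move=> p c c' _ _ _ /lists_profP[lamE muE] /lists_profP[lamE' muE'].
  apply/ffunP => k; have [/codomP[e ->]|] := boolP (k \in codom p.1).
    by rewrite muE muE'.
  move=> kN; apply: val_inj; have := kN; move: kN; rewrite {1}lamE lamE' !mem_enum !inE -!eqn0Ngt.
  by move=> /eqP /= -> /eqP ->.
- move=> [lam mu] [lam' mu'] c _ _ _ /lists_profP[/= lamE muE] /lists_profP[/= lamE' muE'].
  have E : lam = lam'.
    apply/ffunP => e; have /eq_in_map := etrans lamE (esym lamE').
    by apply; rewrite mem_enum.
  by congr (_, _) => //; apply/ffunP => e; rewrite -muE -muE' E.
- by move=> p c _ _ cp; exact: FG.
Qed.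

(** A partition of [n > 0] has at least one block size, and at most [N] distinct ones because size 0
    is excluded, so the range of [d] is exhaustive. *)
Lemma sum_card_supp (V : nmodType) n (F : {ffun 'I_N.+1 -> 'I_N.+1} -> V) : (0 < n)%N ->
  \sum_(1 <= d < N.+1) \sum_(c | prof_ok n c && (#|supp c| == d)) F c =
  \sum_(c | prof_ok n c) F c.
Proof.
move=> n0; rewrite (exchange_big_dep (prof_ok n)) /= => [|d c _ /andP[]//].
apply: eq_bigr => c ok_c; have [/eqP c0 /eqP w] := andP ok_c.
rewrite ok_c (eq_bigl (fun d => d == #|supp c|)) => [|d]; last exact: eq_sym.
rewrite big_nat1_eq ifT //; apply/andP; split.
  rewrite lt0n; apply: contraTneq n0 => /eqP; rewrite cardE size_eq0 => /eqP s0.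
  rewrite -w big1 // => k _; have : k \notin supp c by rewrite -mem_enum s0.
  by rewrite inE -eqn0Ngt => /eqP ->.
have suppN0 : (#|supp c| <= #|predC1 (ord0 : 'I_N.+1)|)%N.
  apply: subset_leq_card; apply/fintype.subsetP => k; rewrite !inE.
  by apply: contraTneq => ->; rewrite c0.
by rewrite ltnS (leq_trans suppN0) // cardC1 card_ord.
Qed.

End Support.

(** * The formula *)

Lemma is_derive_iter (K : numFieldType) (h : K -> K) (T : nat -> K -> K) (n : nat) :
    h = T 0%N ->
    (forall j x, (j < n)%N -> is_derive x (1 : K) (T j) (T j.+1 x)) ->
  forall j, (j <= n)%N -> h^`(j)%classic = T j.
Proof.
move=> h0 dT; elim=> [|j IH] jn; first by rewrite derive1n0.
apply/funext => x; rewrite derive1nS IH; last exact: ltnW.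
by rewrite derive1E (@derive_val _ _ _ _ _ _ _ (dT j x jn)).
Qed.

Theorem theorem4p24 (R : realType) (K : numFieldType)
    (hK : K = R :> numFieldType \/ K = R[i]%C :> numFieldType)
    (m : nat) (hm : (1 <= m)%N)
    (f : 'rV[K]_m -> K) (hf : smooth_mv f)
    (g : 'I_m -> K -> K) (hg : forall l : 'I_m, smooth_1v (g l))
    (h : K -> K) (hh : forall x : K, h x = f (\row_l g l x))
    (kappa : nat) (hkappa : (1 <= kappa)%N) :
  [/\ forall (j : nat) (x : K), (j < kappa)%N -> derivable (h^`(j)) x 1,
      forall (d : nat) (lam mu : {ffun 'I_d -> 'I_kappa.+1}),
        lambda_ok lam -> mu_ok lam mu -> (fdb_denom lam mu %| kappa`!)%N
    & forall x : K,
        h^`(kappa) x =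
        \sum_(1 <= d < kappa.+1)
         \sum_(lam : {ffun 'I_d -> 'I_kappa.+1} | lambda_ok lam)
          \sum_(mu : {ffun 'I_d -> 'I_kappa.+1} | mu_ok lam mu)
           (kappa`!)%:R / (fdb_denom lam mu)%:R *
           \sum_(l : indices m mu)
             partialn (indices_seq l) f (\row_i g i x) *
             \prod_(e < d) \prod_(nu < mu e)
               (g (tnth (l e) nu))^`(lam e)%classic x].
Proof.
have mvbK : mean_value_bound K.
  by case: hK => ->; [exact: mean_value_bound_real|exact: mean_value_bound_complex].
pose W (a : nat) (l : 'I_m) (x : K) : K := (g l)^`(a)%classic x.
pose Phi (ls : seq 'I_m) (x : K) : K := partialn ls f (\row_i g i x).
have PhiP x : perm_invariant (Phi^~ x).
  by move=> ls ls' E; rewrite /Phi (partialn_perm mvbK hf E).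
pose MS s x := multi_sum (fun a l => W a l x) s (Phi^~ x).
have MSP x s t : perm_eq s t -> MS s x = MS t x.
  by move=> st; exact: multi_sum_perm.
have dMS s (x : K) : is_derive x (1 : K) (MS s)
    (MS (1 :: s)%N x + \sum_(a <- s) MS (a.+1 :: rem a s) x).
  apply: is_derive_multi_sum => // [a l|ls].
    by rewrite /W derive1nS derive1E; apply/derivableP/hg.
  apply: (is_derive_chain mvbK).
  - by move=> l y; have [H _] := hf ls; exact: H.
  - by move=> l; have [_ H] := hf (l :: ls).
  - by move=> l; exact: (hg l 0%N).
(* The bound [kappa] on sizes and multiplicities is kept for every [n], so that the index type stays
   fixed along the induction; this is why the steps are restricted to [j < kappa]. *)
pose T n x := \sum_(c : {ffun 'I_kappa.+1 -> 'I_kappa.+1} | prof_ok n c)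
  (n`!)%:R / (prof_denom c)%:R * MS (blocks c) x.
have dT j x : (j < kappa)%N -> is_derive x (1 : K) (T j) (T j.+1 x).
  move=> jk.
  have D := is_derive_big (index_enum {ffun 'I_kappa.+1 -> 'I_kappa.+1}) (P := prof_ok j)
   (fun c _ =>
    is_derive_mulf (is_derive_cst ((j`!)%:R / (prof_denom c)%:R : K) x (1 : K))
                   (dMS (blocks c) x)).
  apply: (is_derive_eq D).
  rewrite /T -(prof_step jk (MSP x)); apply: eq_bigr => c _.
  by rewrite mul0r add0r.
(* The empty partition is the only one of 0, and it has weight 1. *)
have hT : h = T 0%N.
  apply/funext => x; rewrite hh /T (big_pred1 [ffun=> ord0]) => [|c].
    rewrite (_ : prof_denom _ = 1%N); last first.
      by rewrite /prof_denom big1 // => k _; rewrite ffunE.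
    rewrite fact0 divr1 mul1r (_ : blocks _ = [::]) //.
    by apply/nilP; rewrite /nilp size_flatten sumnE big_map big_map big1 // => k _; rewrite ffunE.
  rewrite /prof_ok; apply/andP/eqP => [[/eqP c0]|->]; last first.
    by rewrite ffunE eqxx; split => //; apply/eqP/big1 => k _; rewrite ffunE.
  rewrite sum_nat_eq0 => /forallP H; apply/ffunP => k; apply: val_inj.
  rewrite ffunE; have := H k; rewrite muln_eq0 => /orP[/eqP //|/eqP k0].
  by rewrite (_ : k = ord0) //; exact: val_inj.
have hTj := is_derive_iter hT dT.
split=> [j x jk|d lam mu|x].
- by rewrite hTj ?(ltnW jk) //; exact: (@ex_derive _ _ _ _ _ _ _ (dT j x jk)).
- exact: fdb_denom_dvd.
(* The partitions of [kappa] are grouped by their number [d] of distinct block sizes, then each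
   group is rewritten as a sum over pairs of [lam] and [mu]. *)
rewrite hTj // /T -(sum_card_supp _ hkappa); apply: eq_bigr => d _.
apply/esym; apply: (sum_profiles kappa (G := fun lam mu => (kappa`!)%:R / (fdb_denom lam mu)%:R *
  \sum_(l : indices m mu) partialn (indices_seq l) f (\row_i g i x) *
    \prod_(e < d) \prod_(nu < mu e) (g (tnth (l e) nu))^`(lam e)%classic x)).
move=> c p cp; rewrite (lists_prof_denom cp); congr (_ * _).
by rewrite (MSP _ _ _ (lists_prof_blocks cp)) /MS multi_sum_indices.
Qed.
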